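(* For every $\gamma\in(0,1]$ and $\alpha\geq\gamma$, the approximation ratio of the greedy algorithm on the class $\tilde{\mathcal{F}}_{\gamma,\alpha}$ of monotone, weakly $\gamma$-$\alpha$-augmentable functions is at least $\frac{\alpha}{\gamma}\cdot\frac{e^{\alpha}}{e^{\alpha}-1}$.
   Context: All functions are set functions $f\colon 2^{U}\to\mathbb{R}_{\geq0}$ on some finite ground set $U$; $f$ is monotone if $X\subseteq Y$ implies $f(X)\leq f(Y)$. Write $[n]=\{1,\dots,n\}$. For $k$, $S^{*}_{k}\in\arg\max_{X\subseteq U,|X|\leq k}f(X)$. The greedy algorithm produces $x_1,x_2,\dots$ with $x_i\in\arg\max_{x\in U\setminus\{x_1,\dots,x_{i-1}\}} f(\{x_1,\dots,x_{i-1}\}\cup\{x\})$, and $S^{G}_i=\{x_1,\dots,x_i\}$, $S^{G}_0=\emptyset$; ties are broken by some rule, and each function is considered together with a fixed such greedy run, to which all notions referring to greedy sets refer. $\bar{k}\in[|U|]$ is the smallest index such that $f(S^{G}_{\bar k}\cup\{x\})=f(S^{G}_{\bar k})$ for all $x\in U\setminus S^{G}_{\bar k}$. For $\gamma\in(0,1]$, $\alpha\geq\gamma$, $f$ is weakly $\gamma$-$\alpha$-augmentable if for all $X\in\{S^{G}_0,\dots,S^{G}_{\bar k}\}$ and all $Y\subseteq U$ with $Y\nsubseteq X$ there is $y\in Y$ with $f(X\cup\{y\})-f(X)\geq\frac{\gamma f(X\cup Y)-\alpha f(X)}{|Y|}$. $\tilde{\mathcal{F}}_{\gamma,\alpha}$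 is the set of monotone weakly $\gamma$-$\alpha$-augmentable functions (each with its greedy run). The approximation ratio of the greedy algorithm on a class $\mathcal{F}$ is $\sup_{f\in\mathcal{F}}\max_{k\in[|U|]} f(S^{*}_{k})/f(S^{G}_{k})$. *)

(* Defs.v *)
From HB Require Import structures.
From mathcomp Require Import all_boot all_order all_algebra.
From mathcomp Require Import boolp classical_sets reals constructive_ereal ereal.
From mathcomp Require Import sequences exp.

Set Implicit Arguments.
Unset Strict Implicit.
Unset Printing Implicit Defensive.

Import Order.TTheory GRing.Theory Num.Theory.
Local Open Scope ring_scope.
Local Open Scope set_scope.

(* Runs are indexed from 0: [x j] is the element x_{j+1} chosen in round j+1. *)
Definition greedy_set (U : finType) (x : 'I_#|U| -> U) (i : nat) : {set U} :=
  [set x j | j : 'I_#|U| & (j < i)%N].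

Definition greedy_run (R : realType) (U : finType) (f : {set U} -> R)
    (x : 'I_#|U| -> U) : Prop :=
  forall i : 'I_#|U|,
    x i \notin greedy_set x i /\
    forall y, y \notin greedy_set x i ->
      f (greedy_set x i :|: [set y]) <= f (greedy_set x i :|: [set x i]).

(* A nonnegative set function together with its fixed greedy run. The ground
   set is nonempty because kbar below has to lie in {1, ..., #|U|}. *)
Record instance (R : realType) : Type := Instance {
  ground : finType;
  objective : {set ground} -> R;
  run : 'I_#|ground| -> ground;
  ground_gt0 : (0 < #|ground|)%N;
  objective_ge0 : forall X, 0 <= objective X;
  runP : greedy_run objective run
}.

Definition SG (R : realType) (I : instance R) (i : nat) : {set ground I} :=
  greedy_set (@run R I) i.

Definition stationary (R : realType) (I : instance R) (k : nat) : bool :=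
  [forall x : ground I, (x \notin SG I k) ==>
     (objective (SG I k :|: [set x]) == objective (SG I k))].

Lemma run_inj (R : realType) (I : instance R) : injective (@run R I).
Proof.
have H (i j : 'I_#|ground I|) : (i < j)%N -> run i <> run j.
  move=> ij E; have [/negP[]] := runP j.
  by rewrite -E /greedy_set; apply: imset_f; rewrite inE.
by move=> i j E; apply/val_inj; case: (ltngtP i j) => // /H; rewrite E.
Qed.

Lemma exists_stationary (R : realType) (I : instance R) :
  exists k, (1 <= k <= #|ground I|)%N && stationary I k.
Proof.
exists #|ground I|; rewrite ground_gt0 leqnn /=.
suff -> : stationary I #|ground I| = true by [].
apply/forallP => y; apply/implyP => /negP[].
have /subset_cardP : #|codom (@run R I)| = #|ground I|.
  by rewrite (card_codom (@run_inj R I)) card_ord.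
move=> /(_ (subset_predT _)) /(_ y).
rewrite inE => /codomP[j ->].
by apply: imset_f; rewrite inE ltn_ord.
Qed.

Definition kbar (R : realType) (I : instance R) : nat :=
  ex_minn (exists_stationary I).

Definition monotone (R : realType) (I : instance R) : Prop :=
  forall X Y : {set ground I}, X \subset Y -> objective X <= objective Y.

Definition weakly_augmentable (R : realType) (gamma alpha : R)
    (I : instance R) : Prop :=
  forall i : nat, (i <= kbar I)%N ->
  forall Y : {set ground I}, ~~ (Y \subset SG I i) ->
  exists2 y, y \in Y &
    (gamma * objective (SG I i :|: Y) - alpha * objective (SG I i)) / #|Y|%:R
      <= objective (SG I i :|: [set y]) - objective (SG I i).

Definition Ftilde (R : realType) (gamma alpha : R) (I : instance R) : Prop :=
  monotone I /\ weakly_augmentable gamma alpha I.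

Definition Sstar (R : realType) (I : instance R) (k : nat) : {set ground I} :=
  [arg max_(X > finset.set0 | (#|X| <= k)%N) objective X]%O.

(* Division in the extended reals: a / 0 = +oo for a > 0, and 0 / 0 = 0. *)
Definition greedy_ratio (R : realType) (I : instance R) : \bar R :=
  \big[Order.max/-oo%E]_(1 <= k < #|ground I|.+1)
    ((objective (Sstar I k))%:E / (objective (SG I k))%:E)%E.

(* Classes are predicates rather than [set (instance R)]: [instance R] lives in
   a universe too large for [set]. *)
Definition approx_ratio (R : realType) (F : instance R -> Prop) : \bar R :=
  ereal_sup [set r | exists2 I, F I & greedy_ratio I = r]%classic.

(* Main.v *)
Require Import Defs.
From mathcomp Require Import all_boot all_order all_algebra.
From mathcomp Require Import boolp classical_sets reals constructive_ereal ereal.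
From mathcomp Require Import sequences exp.
From mathcomp Require Import fintype finset.
From mathcomp Require Import zify lra ring.
Import Order.TTheory GRing.Theory Num.Theory.
Local Open Scope ring_scope.

(** The ground set consists of [N] interchangeable decoys and a block of [k]
    elements worth 1 in total.  An incomplete part of the block is worth only as
    much as one additional decoy, so ties let the greedy algorithm pick the decoys
    first.  A set of [i] decoys has value [F i = L - deficit i] with
    [L = gamma / alpha], and augmentability by the whole block forces
    [gamma - alpha * F i <= k * (F i.+1 - F i)].  Equality in the first [k] rounds
    gives [F k = L * (1 - (1 - alpha / k) ^+ k)], hence the ratio in the limit.
    After round [k] the gains are kept constant, so that [F] reaches [L] after
    finitely many rounds; there augmentability allows all gains to vanish,
    and the greedy sets beyond that round are unconstrained. *)

(** * The set function with decoys and a block *)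

Definition optimal_part (N k : nat) : {set 'I_(N + k)} :=
  [set j : 'I_(N + k) | N <= j]%N.

Definition weight (N k : nat) (A : {set 'I_(N + k)}) : nat :=
  #|A :\: optimal_part N k| + ~~ [disjoint A & optimal_part N k].

Definition tight_value (R : realType) (F : nat -> R) (N k : nat)
    (A : {set 'I_(N + k)}) : R :=
  if optimal_part N k \subset A then 1 else F (weight N k A).

Definition initial (n i : nat) : {set 'I_n} := [set j : 'I_n | j < i]%N.

(** Rounds are indexed by ['I_#|{: 'I_n}|], so taking the elements in index order requires a cast.
    Decoys have the indices below [N] and hence come first. *)
Definition index_run (n : nat) : 'I_#|{: 'I_n}| -> 'I_n :=
  cast_ord (card_ord n).

Lemma card_initial (n i : nat) : (i <= n)%N -> #|initial n i| = i.
Proof.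
move=> lein; have <- : widen_ord lein @: [set: 'I_i] = initial n i.
  apply/setP => j; rewrite inE; apply/imsetP/idP => [[l _ ->] //=|ltji].
  by exists (Ordinal ltji) => //; apply/val_inj.
by rewrite card_imset ?cardsT ?card_ord // => a b /(congr1 val) /= /val_inj.
Qed.

Lemma optimal_partC (N k : nat) : ~: optimal_part N k = initial (N + k) N.
Proof. by apply/setP => j; rewrite !inE -ltnNge. Qed.

Lemma card_optimal_part (N k : nat) : #|optimal_part N k| = k.
Proof.
have := cardsC (optimal_part N k).
by rewrite optimal_partC card_initial ?leq_addr // card_ord; lia.
Qed.

Lemma greedy_set_index_run (n i : nat) :
  greedy_set (index_run n) i = initial n i.
Proof.
apply/setP => j; rewrite inE; apply/imsetP/idP => [[l]|ltji].
  by rewrite inE => li ->.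
by exists (cast_ord (esym (card_ord n)) j); rewrite ?inE //; apply/val_inj.
Qed.

Lemma weight_le_card (N k : nat) (A : {set 'I_(N + k)}) :
  (weight N k A <= #|A|)%N.
Proof.
rewrite /weight -(cardsID (optimal_part N k) A) addnC leq_add2r.
by rewrite -setI_eq0 -card_gt0; case: #|A :&: _|.
Qed.

Lemma weight_mono (N k : nat) (A B : {set 'I_(N + k)}) :
  A \subset B -> (weight N k A <= weight N k B)%N.
Proof.
move=> AB; apply: leq_add; first exact/subset_leq_card/setSD.
by have := @disjointWl _ (mem A) (mem B) (mem (optimal_part N k)) AB;
  case: [disjoint B & _]; case: [disjoint A & _] => // /(_ isT).
Qed.

Lemma weight_initial (N k i : nat) :
  (i <= N)%N -> weight N k (initial (N + k) i) = i.
Proof.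
move=> leiN; have dis : [disjoint initial (N + k) i & optimal_part N k].
  by apply/pred0P => j /=; rewrite !inE; lia.
rewrite /weight dis addn0 (setDidPl _) // card_initial //; lia.
Qed.

(** A new decoy raises the cardinality term; a block element raises the indicator from 0 to 1. *)
Lemma weight_initialU1 (N k i : nat) (y : 'I_(N + k)) :
  (i <= N)%N -> y \notin initial (N + k) i ->
  weight N k (initial (N + k) i :|: [set y]) = i.+1.
Proof.
move=> leiN yi; have dis : [disjoint initial (N + k) i & optimal_part N k].
  by apply/pred0P => j /=; rewrite !inE; lia.
rewrite /weight setDUl (setDidPl dis) -setI_eq0 setIUl.
move: (dis); rewrite -setI_eq0 => /eqP ->; rewrite set0U.
case: (boolP (y \in optimal_part N k)) => yO.
  rewrite (eqP (_ : [set y] :\: _ == set0)) ?setD_eq0 ?sub1set //.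
  rewrite setU0 card_initial; last by lia.
  by rewrite (setIidPl _) ?sub1set // -card_gt0 cards1 addn1.
have disy : [disjoint [set y] & optimal_part N k] by rewrite disjoints1.
rewrite (setDidPl disy) setIC (setUC _ [set y]) cardsU1 yi card_initial; last lia.
by rewrite setIC setI_eq0 disy addn0.
Qed.

(* Every element outside [initial (N + k) i] gives the same gain, so any
   enumeration that starts with the complement of [optimal_part] is greedy. *)
Lemma tight_value_initialU1 (R : realType) (F : nat -> R) (N k i : nat)
    (y : 'I_(N + k)) :
  (1 < k)%N -> (i <= N)%N -> y \notin initial (N + k) i ->
  tight_value R F N k (initial (N + k) i :|: [set y]) = F i.+1.
Proof.
move=> k1 leiN yi; rewrite /tight_value weight_initialU1 //.
(* The initial segment misses the block, and a single element cannot complete a block of size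
   [k > 1]. *)
case: ifP => // /(setSI (optimal_part N k)) /subset_leq_card.
rewrite setIid card_optimal_part setIUl (eqP (_ : initial _ _ :&: _ == set0)).
  rewrite set0U => /leq_trans/(_ (subset_leq_card (subsetIl _ _))).
  rewrite cards1; lia.
by rewrite setI_eq0; apply/pred0P => j /=; rewrite !inE; lia.
Qed.

(** * Greedy run, augmentability and ratio of the instance *)

(** While [i <= N] all candidates tie. Afterwards the decoys are exhausted and [F] is flat, so only
    completing the block could break a tie. *)
Lemma index_run_greedy (R : realType) (F : nat -> R) (N k : nat) :
  (1 < k)%N -> (forall i, (N <= i)%N -> F i = F N) ->
  greedy_run (tight_value R F N k) (index_run (N + k)).
Proof.
move=> k1 FN i; rewrite greedy_set_index_run.
have xi : index_run (N + k) i \notin initial (N + k) i by rewrite inE /= ltnn.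
split=> // y yi.
have [leiN|ltNi] := leqP i N; first by rewrite !tight_value_initialU1.
have iNk : (i < N + k)%N by rewrite -[X in (_ < X)%N]card_ord ltn_ord.
have card_ext (z : 'I_(N + k)) : z \notin initial (N + k) i ->
    #|initial (N + k) i :|: [set z]| = i.+1.
  by move=> zi; rewrite setUC cardsU1 zi card_initial // ltnW.
have weight_ext (z : 'I_(N + k)) :
    F (weight N k (initial (N + k) i :|: [set z])) = F N.
  apply: FN; rewrite -[X in (X <= _)%N](weight_initial N k N) //.
  by apply: weight_mono; apply/subsetP => j; rewrite !inE => /ltn_trans ->.
(* With all decoys present, completing the block exhausts the ground set; by cardinality every other
   one-element extension then does so too. *)
have full_ext (z w : 'I_(N + k)) :
    z \notin initial (N + k) i -> w \notin initial (N + k) i ->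
    optimal_part N k \subset initial (N + k) i :|: [set z] ->
    optimal_part N k \subset initial (N + k) i :|: [set w].
  move=> zi wi sub; have zT : initial (N + k) i :|: [set z] = [set: _].
    apply/eqP; rewrite -subTset -(setUCr (optimal_part N k)) subUset sub.
    rewrite optimal_partC; apply/subsetP => j; rewrite !inE => jN.
    by rewrite (ltn_trans jN).
  suff -> : initial (N + k) i :|: [set w] = [set: _] by exact: subsetT.
  by apply/eqP; rewrite eqEcard subsetT -zT !card_ext //=.
rewrite /tight_value !weight_ext (_ : (_ \subset _) = (optimal_part N k \subset
  initial (N + k) i :|: [set index_run (N + k) i])) //.
by apply/idP/idP; apply: full_ext.
Qed.

Lemma tight_ground_gt0 (N k : nat) : (1 < k)%N -> (0 < #|{: 'I_(N + k)}|)%N.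
Proof. by rewrite card_ord; lia. Qed.

Lemma tight_value_ge0 (R : realType) (F : nat -> R) (N k : nat) :
  (forall i, 0 <= F i) -> forall A, 0 <= tight_value R F N k A.
Proof. by move=> F0 A; rewrite /tight_value; case: ifP. Qed.

Definition tight_instance (R : realType) (F : nat -> R) (N k : nat)
    (k_gt1 : (1 < k)%N) (F_ge0 : forall i, 0 <= F i)
    (F_stat : forall i, (N <= i)%N -> F i = F N) : instance R :=
  @Instance R 'I_(N + k) (tight_value R F N k) (index_run (N + k))
    (tight_ground_gt0 N k k_gt1) (tight_value_ge0 R F N k F_ge0)
    (index_run_greedy R F N k k_gt1 F_stat).

Lemma tight_value_initial (R : realType) (F : nat -> R) (N k i : nat) :
  (0 < k)%N -> (i <= N)%N -> tight_value R F N k (initial (N + k) i) = F i.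
Proof.
move=> k0 leiN; rewrite /tight_value weight_initial //; case: ifP => // sub.
have : optimal_part N k :&: optimal_part N k \subset set0.
  apply/subsetP => j; rewrite inE => /andP[/(subsetP sub)]; rewrite !inE; lia.
by rewrite setIid subset0 -cards_eq0 card_optimal_part; lia.
Qed.

(** At [N] the flatness of [F] makes every single gain vanish. The bound confines augmentability to
    greedy sets made of decoys only. *)
Lemma kbar_tight (R : realType) (F : nat -> R) (N k : nat) (k_gt1 : (1 < k)%N)
    (F_ge0 : forall i, 0 <= F i)
    (F_stat : forall i, (N <= i)%N -> F i = F N) :
  (0 < N)%N -> (kbar (tight_instance R F N k k_gt1 F_ge0 F_stat) <= N)%N.
Proof.
move=> N0; rewrite /kbar; case: ex_minnP => m _; apply.
rewrite N0 /= card_ord leq_addr /=; apply/forallP => y; apply/implyP.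
rewrite /SG /= greedy_set_index_run => yN; apply/eqP.
by rewrite tight_value_initialU1 // tight_value_initial ?(ltnW k_gt1) // F_stat.
Qed.

(** All gains being equal, any [y] of [Y] outside the greedy set is a witness. If [Y] completes the
    block, it contains the block, so [#|Y| >= k] and the gain hypothesis applies; otherwise the
    joint value is at most [F (i + #|Y|)] and concavity suffices. *)
Lemma tight_instance_Ftilde (R : realType) (gamma alpha : R) (F : nat -> R)
    (N k : nat) (k_gt1 : (1 < k)%N) (F_ge0 : forall i, 0 <= F i)
    (F_stat : forall i, (N <= i)%N -> F i = F N) :
  (0 < N)%N -> 0 < gamma -> gamma <= 1 -> gamma <= alpha ->
  (forall i, F i <= 1) -> {homo F : i j / (i <= j)%N >-> i <= j} ->
  (forall i m, F (i + m)%N - F i <= (F i.+1 - F i) *+ m) ->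
  (forall i, gamma - alpha * F i <= (F i.+1 - F i) *+ k) ->
  Ftilde gamma alpha (tight_instance R F N k k_gt1 F_ge0 F_stat).
Proof.
move=> N0 g0 g1 ga F1 Fmono Fconc Fgain; split.
  move=> X Y XY /=; rewrite /tight_value; case: ifP => [/subset_trans/(_ XY)->//|_].
  by case: ifP => // _; apply/Fmono/weight_mono.
move=> i /leq_trans/(_ (kbar_tight _ _ _ _ _ _ _ N0)) leiN Y.
rewrite /SG /= greedy_set_index_run => /subsetPn[y yY yi]; exists y => //.
rewrite tight_value_initialU1 // tight_value_initial ?(ltnW k_gt1) //.
have Y0 : (0 < #|Y|)%N by apply/card_gt0P; exists y.
rewrite ler_pdivrMr ?ltr0n // mulr_natr.
have gain0 : 0 <= F i.+1 - F i by rewrite subr_ge0 Fmono.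
rewrite {1}/tight_value; case: ifP => [sub|_].
  rewrite mulr1; apply: le_trans (Fgain i) _; rewrite ler_wpMn2l //.
  apply: (@leq_trans #|optimal_part N k|); first by rewrite card_optimal_part.
  apply/subset_leq_card/subsetP => j jO.
  have := subsetP sub _ jO; rewrite !inE => /orP[ji|//].
  by move: jO; rewrite inE; lia.
have wle : (weight N k (initial (N + k) i :|: Y) <= i + #|Y|)%N.
  apply: leq_trans (weight_le_card _ _ _) _.
  apply: leq_trans (leq_card_setU _ _) _; rewrite card_initial //; lia.
(* Since [gamma <= alpha] and [0 <= F i], [alpha] may be lowered to [gamma]; afterwards [gamma <= 1]
   removes the common factor. *)
have /le_trans : gamma * F (weight N k (initial (N + k) i :|: Y)) - alpha * F i
    <= gamma * (F (i + #|Y|)%N - F i).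
  by rewrite mulrBr lerB ?ler_wpM2l ?ler_wpM2r ?(ltW g0) ?Fmono.
apply; apply: le_trans _ (Fconc _ _).
by rewrite ler_piMl // subr_ge0 Fmono // leq_addr.
Qed.

(** The block is a competitor of size [k] and value 1, while the greedy set of round [k <= N] holds
    only decoys. *)
Lemma greedy_ratio_tight (R : realType) (F : nat -> R)
    (N k : nat) (k_gt1 : (1 < k)%N) (F_ge0 : forall i, 0 <= F i)
    (F_stat : forall i, (N <= i)%N -> F i = F N) :
  (k <= N)%N -> 0 < F k ->
  ((F k)^-1%:E <= greedy_ratio (tight_instance R F N k k_gt1 F_ge0 F_stat))%E.
Proof.
move=> kN Fk; rewrite /greedy_ratio /=.
apply: (@Order.TotalTheory.bigmax_sup_seq _ _ _ _ _ k) => //.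
  by rewrite mem_index_iota card_ord; lia.
rewrite /SG /= greedy_set_index_run tight_value_initial ?(ltnW k_gt1) //.
rewrite inver gt_eqF // -EFinM lee_fin ler_peMl ?invr_ge0 ?(ltW Fk) //.
rewrite /Sstar; case: arg_maxP => /= [|A _ /(_ (optimal_part N k))].
  by rewrite cards0.
by rewrite card_optimal_part => /(_ (leqnn _)); rewrite {1}/tight_value subxx.
Qed.

(** * The deficit sequence *)

(* The minimum with the current deficit makes it stop at exactly 0. *)
Fixpoint deficit (R : realType) (e L : R) (k i : nat) : R :=
  if i is i'.+1 then
    deficit R e L k i' -
      Num.min (deficit R e L k i') (e * (L * (1 - e) ^+ minn i' k))
  else L.

Definition deficit_drop (R : realType) (e L : R) (k i : nat) : R :=
  Num.min (deficit R e L k i) (e * (L * (1 - e) ^+ minn i k)).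

Lemma deficitS (R : realType) (e L : R) (k i : nat) :
  deficit R e L k i.+1 = deficit R e L k i - deficit_drop R e L k i.
Proof. by []. Qed.

Lemma deficit_ge0 (R : realType) (e L : R) (k i : nat) :
  0 <= L -> 0 <= deficit R e L k i.
Proof. by case: i => //= i _; rewrite subr_ge0 ge_min lexx. Qed.

Lemma deficit_drop_ge0 (R : realType) (e L : R) (k i : nat) :
  0 <= e <= 1 -> 0 <= L -> 0 <= deficit_drop R e L k i.
Proof.
move=> /andP[e0 e1] L0.
by rewrite le_min deficit_ge0 // !mulr_ge0 // exprn_ge0 // subr_ge0.
Qed.

Lemma deficit_nonincreasing (R : realType) (e L : R) (k : nat) :
  0 <= e <= 1 -> 0 <= L ->
  {homo deficit R e L k : i j / (i <= j)%N >-> j <= i}.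
Proof.
move=> he L0 i j /subnKC <-; elim: (j - i)%N => [|m IHm]; first by rewrite addn0.
by rewrite addnS deficitS; have := deficit_drop_ge0 R e L k (i + m) he L0; lra.
Qed.

(** Both entries of the minimum are nonincreasing. The drops are the gains of [F], so this is the
    concavity of [F]. *)
Lemma deficit_drop_nonincreasing (R : realType) (e L : R) (k : nat) :
  0 <= e <= 1 -> 0 <= L ->
  {homo deficit_drop R e L k : i j / (i <= j)%N >-> j <= i}.
Proof.
move=> /[dup] he /andP[e0 e1] L0 i j lij; rewrite /deficit_drop le_min !ge_min.
rewrite deficit_nonincreasing //=; apply/orP; right.
by rewrite ler_wpM2l // ler_wpM2l // ler_wiXn2l ?subr_ge0 //; [lra | lia].
Qed.

(** As [e <= 1], the second entry attains the minimum, so each of the first [k] rounds multiplies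
    the deficit by [1 - e]. *)
Lemma deficit_geometric (R : realType) (e L : R) (k i : nat) :
  0 <= e <= 1 -> 0 <= L -> (i <= k)%N -> deficit R e L k i = L * (1 - e) ^+ i.
Proof.
move=> /andP[e0 e1] L0; elim: i => [|i IHi] lik /=; first by rewrite mulr1.
rewrite (minn_idPl (ltnW lik)) IHi ?(ltnW lik) // min_r ?exprS; first ring.
by rewrite ler_piMl // mulr_ge0 // exprn_ge0 // subr_ge0.
Qed.

(** With [e = alpha / k] this is the gain inequality forced by the block, divided by [k]. It
    persists past round [k], where the drop is frozen or takes the whole deficit, while the deficit
    only shrinks. *)
Lemma deficit_le_drop (R : realType) (e L : R) (k i : nat) :
  0 <= e <= 1 -> 0 <= L -> e * deficit R e L k i <= deficit_drop R e L k i.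
Proof.
move=> /[dup] he /andP[e0 e1] L0; rewrite le_min ler_piMl ?deficit_ge0 //=.
rewrite ler_wpM2l // -(deficit_geometric _ _ _ k) ?geq_minr //.
by rewrite deficit_nonincreasing // geq_minl.
Qed.

Lemma deficit_sub_le (R : realType) (e L : R) (k i m : nat) :
  0 <= e <= 1 -> 0 <= L ->
  deficit R e L k i - deficit R e L k (i + m) <= deficit_drop R e L k i *+ m.
Proof.
move=> he L0; elim: m => [|m IHm]; first by rewrite addn0 subrr.
rewrite addnS deficitS mulrSr.
by have := deficit_drop_nonincreasing R e L k he L0 i (i + m)%N (leq_addr _ _); lra.
Qed.

Lemma deficit_vanishes (R : realType) (e L : R) (k m i : nat) :
  0 <= e <= 1 -> 0 <= L -> 1 <= e * m%:R -> (k + m <= i)%N ->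
  deficit R e L k i = 0.
Proof.
move=> /[dup] he /andP[e0 e1] L0 em kmi.
have D0 := deficit_ge0 R e L k _ L0.
have c0 : 0 <= L * (1 - e) ^+ k by rewrite mulr_ge0 // exprn_ge0 // subr_ge0.
(* From round [k] on the deficit falls by the constant [e * (L * (1 - e) ^+ k)] until it hits 0, so
   [m] rounds with [e * m >= 1] suffice. *)
have linear j : deficit R e L k (k + j) <=
    Num.max 0 (L * (1 - e) ^+ k * (1 - e * j%:R)).
  elim: j => [|j IHj].
    by rewrite addn0 deficit_geometric // le_max mulr0 subr0 mulr1 lexx orbT.
  rewrite addnS /= (minn_idPr (leq_addr _ _)) le_max.
  have ec0 := mulr_ge0 e0 c0.
  move: IHj; rewrite le_max minEle -natr1.
  by case: ifP => _; rewrite ?subrr ?lexx // => /orP[|] H; apply/orP;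
    [left|right]; lra.
apply/le_anti; rewrite D0 andbT.
apply: le_trans (deficit_nonincreasing _ _ _ _ he L0 _ _ kmi) _.
apply: le_trans (linear m) _; rewrite ge_max lexx /= mulr_ge0_le0 ?subr_le0 //.
Qed.

(** * Passage to the limit in the block size *)

(** Follows from [1 - x >= expR (- (x / (1 - x)))] at [x = alpha / k], raised to the power [k]. This
    direction bounds the greedy value from above. *)
Lemma expr_approx_expR (R : realType) (alpha eps : R) :
  0 < alpha -> 0 < eps ->
  exists2 k : nat, (1 < k)%N && (alpha < k%:R) &
    expR (- alpha) - eps <= (1 - alpha / k%:R) ^+ k.
Proof.
move=> a0 eps0.
(* [k > B] yields [k > 1], [k > alpha] and [alpha ^+ 2 / (k - alpha) <= eps], the excess in the
   exponent below. *)
pose B : R := 1 + alpha + alpha ^+ 2 / eps.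
have q0 : 0 < alpha ^+ 2 / eps by rewrite divr_gt0 // exprn_gt0.
exists (Num.bound B).+1.
  have : B < (Num.bound B).+1%:R.
    by apply: lt_trans (archi_boundP _ ) _; rewrite ?ltr_nat /B //; lra.
  rewrite -(ltr_nat R) => h; apply/andP; split; apply: lt_trans h; rewrite /B; lra.
have : B < (Num.bound B).+1%:R.
  by apply: lt_trans (archi_boundP _ ) _; rewrite ?ltr_nat /B //; lra.
move: (Num.bound B).+1 => k; rewrite /B => kB.
have k0 : 0 < k%:R :> R by lra.
have ka : 0 < k%:R - alpha by lra.
(* With [y = x / (1 - x)], [1 + y <= expR y] reads [expR (- y) <= 1 - x]. *)
have base : expR (- (alpha / (k%:R - alpha))) <= 1 - alpha / k%:R.
  rewrite expRN -[leRHS]invrK lef_pV2 ?posrE ?expR_gt0 ?invr_gt0 //; last first.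
    by rewrite subr_gt0 ltr_pdivrMr // mul1r; lra.
  apply: le_trans _ (expR_ge1Dx _); rewrite le_eqVlt; apply/orP; left; apply/eqP.
  by field; rewrite !lt0r_neq0.
apply: le_trans _ (lerXn2r k _ _ base); rewrite ?nnegrE ?expR_ge0 //; last first.
  exact: le_trans (expR_ge0 _) base.
rewrite -expRM_natl.
have -> : k%:R * - (alpha / (k%:R - alpha)) =
    - alpha - alpha ^+ 2 / (k%:R - alpha) by field; rewrite lt0r_neq0.
rewrite expRD.
have y0 : alpha ^+ 2 / (k%:R - alpha) <= eps.
  rewrite ler_pdivrMr // -ler_pdivrMl // mulrC; lra.
(* An excess [d] in the exponent costs at most [d], because [expR (- d) >= 1 - d] and
   [expR (- alpha) <= 1]. *)
have := expR_ge1Dx (- (alpha ^+ 2 / (k%:R - alpha))).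
have : expR (- alpha) <= 1 by rewrite expR_le1; lra.
have := expR_gt0 (- alpha); nra.
Qed.

Lemma approx_ratio_ge (R : realType) (gamma alpha : R) (k : nat) :
  0 < gamma -> gamma <= 1 -> gamma <= alpha -> (1 < k)%N -> alpha < k%:R ->
  ((alpha / gamma / (1 - (1 - alpha / k%:R) ^+ k))%:E
     <= approx_ratio (Ftilde gamma alpha))%E.
Proof.
move=> g0 g1 ga k1 ak; have a0 : 0 < alpha by apply: lt_le_trans ga.
have k0 : 0 < k%:R :> R by rewrite ltr0n ltnW.
pose e := alpha / k%:R; pose L := gamma / alpha.
have e0 : 0 < e by rewrite divr_gt0.
have e1 : e < 1 by rewrite ltr_pdivrMr // mul1r.
have he : 0 <= e <= 1 by rewrite !ltW.
have L0 : 0 < L by rewrite divr_gt0.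
have L1 : L <= 1 by rewrite ler_pdivrMr // mul1r.
have aL : alpha * L = gamma by rewrite /L; field; rewrite lt0r_neq0.
have ke : e * k%:R = alpha by rewrite /e; field; rewrite lt0r_neq0.
(* [m] rounds of constant gain clear the deficit left after round [k], whence [N = k + m] decoys. *)
pose m := Num.bound e^-1.
have em : 1 <= e * m%:R.
  by rewrite mulrC -ler_pdivrMr // mul1r ltW // archi_boundP // invr_ge0 ltW.
pose F i := L - deficit R e L k i.
have FS i : F i.+1 - F i = deficit_drop R e L k i by rewrite /F deficitS; ring.
have F_ge0 i : 0 <= F i.
  by rewrite subr_ge0; apply: (deficit_nonincreasing R e L k he (ltW L0) 0%N).
have F_stat i : (k + m <= i)%N -> F i = F (k + m)%N.
  by move=> kmi; rewrite /F !(deficit_vanishes R e L k m) // ltW.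
have Fk : F k = L * (1 - (1 - e) ^+ k).
  by rewrite /F deficit_geometric ?(ltW L0) //; ring.
have Fk0 : 0 < F k.
  by rewrite Fk mulr_gt0 // subr_gt0 exprn_ilt1 ?gtn_eqF ?(ltnW k1) //; lra.
have := greedy_ratio_tight R F (k + m) k k1 F_ge0 F_stat (leq_addr _ _) Fk0.
have -> : (F k)^-1 = alpha / gamma / (1 - (1 - alpha / k%:R) ^+ k).
  by rewrite Fk invfM /L invf_div.
move=> /le_trans; apply; apply: ereal_sup_ubound.
exists (tight_instance R F (k + m) k k1 F_ge0 F_stat) => //.
apply: tight_instance_Ftilde => //; first by rewrite addn_gt0 (ltnW k1).
- by move=> i; rewrite /F; have := deficit_ge0 R e L k i (ltW L0); lra.
- move=> i j lij; rewrite /F lerD2l lerN2.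
  by apply: deficit_nonincreasing => //; exact: ltW.
- move=> i n; rewrite FS /F.
  have := deficit_sub_le R e L k i n he (ltW L0); lra.
(* As [alpha * L = gamma], the left side is [alpha] times the deficit, and [alpha = e * k]. *)
- move=> i; rewrite FS -mulr_natr /F mulrBr aL opprB addrC subrK.
  have := deficit_le_drop R e L k i he (ltW L0).
  by rewrite -(ler_pM2r k0) mulrAC ke.
Qed.

Theorem theorem23 (R : realType) (gamma alpha : R)
    (gamma_gt0 : 0 < gamma) (gamma_le1 : gamma <= 1)
    (gamma_le_alpha : gamma <= alpha) :
  ((alpha / gamma * (expR alpha / (expR alpha - 1)))%:E
     <= approx_ratio (Ftilde gamma alpha))%E.
Proof.
have a0 : 0 < alpha by apply: lt_le_trans gamma_le_alpha.
have E1 : 1 < expR alpha by rewrite expR_gt1.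
have -> : expR alpha / (expR alpha - 1) = (1 - expR (- alpha))^-1.
  by rewrite expRN; field; rewrite !lt0r_neq0 //; lra.
have D0 : 0 < 1 - expR (- alpha) by rewrite subr_gt0 expR_lt1; lra.
pose c := alpha / gamma; have c0 : 0 < c by rewrite divr_gt0.
(* Each [eps] is served by its own block size [k]; the supremum over the class absorbs the limit. *)
have lower eps : 0 < eps -> ((c / (1 - expR (- alpha) + eps))%:E
    <= approx_ratio (Ftilde gamma alpha))%E.
  move=> eps0; have [k /andP[k1 ak] approx] := expr_approx_expR R alpha eps a0 eps0.
  have k0 : 0 < k%:R :> R by rewrite ltr0n ltnW.
  have e0 : 0 < alpha / k%:R by rewrite divr_gt0.
  have e1 : alpha / k%:R < 1 by rewrite ltr_pdivrMr // mul1r.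
  have := approx_ratio_ge R gamma alpha k gamma_gt0 gamma_le1 gamma_le_alpha k1 ak.
  apply: le_trans; rewrite lee_fin ler_pM2l // lef_pV2 ?posrE; [lra | lra |].
  by rewrite subr_gt0 exprn_ilt1 ?gtn_eqF ?(ltnW k1) //; lra.
case: (approx_ratio _) lower => [s | | ] lower; rewrite ?leey //; last first.
  by have := lower 1 ltr01.
rewrite lee_fin ler_pdivrMr // leNgt; apply/negP => small.
have s0 : 0 < s.
  have := lower 1 ltr01; rewrite lee_fin; apply: lt_le_trans.
  by rewrite divr_gt0 //; lra.
(* With this [eps], [s * (1 - expR (- alpha) + eps)] is the midpoint of [s * (1 - expR (- alpha))]
   and [c], hence below [c], against [lower]. *)
pose eps := (c - s * (1 - expR (- alpha))) / (2 * s).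
have eps0 : 0 < eps by rewrite divr_gt0 // ?mulr_gt0 // subr_gt0.
have := lower _ eps0; rewrite lee_fin ler_pdivrMr; last lra.
have sepsE : s * eps = (c - s * (1 - expR (- alpha))) / 2.
  by rewrite /eps; field; rewrite lt0r_neq0.
rewrite mulrDr sepsE; move: small; rewrite -/c; clearbody c.
by move: (s * (1 - expR (- alpha))) => t; lra.
Qed.
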